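(* Let $\chi=(x_0,\dots,x_N)$ with $a=x_0<x_1<\dots<x_N=b$ be a partition of $[a,b]$, let $\delta_{max}=\max_{0\le i\le N-1}(x_{i+1}-x_i)$, and let $C$ be a constant. Let $\phi:[a,b]\times\mathbb R_+\to\mathbb R_+$ be a continuous function, non-decreasing in its second argument, with $\phi(x,0)=0$ for all $x$. Let $F:[a,b]\to K(\mathbb R^n)$ be a set-valued function which is continuous and of bounded variation (with respect to the Hausdorff distance), and let $A_\chi(f,x)=\sum_{i=0}^N c_i(x)f(x_i)$, with $c_i:[a,b]\to\mathbb R$, be a linear operator satisfying, for every $s\in\mathcal S_\chi$ and every $x\in[a,b]$, $$|A_\chi(s,x)-s(x)|\le C\,\omega_{[a,b]}\big(s,\phi(x,\delta_{max})\big).$$ Then for every $x\in[a,b]$, $$\mathrm{haus}\big(A^M_\chi(F,x),F(x)\big)\le 2\,\omega_{[a,b]}(F,\delta_{max})+5C\,\omega_{[a,b]}\big(v_F,\phi(x,\delta_{max})\big).$$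
   Context: $\mathbb R_+=[0,\infty)$. $K(\mathbb R^n)$ is the collection of all nonempty compact subsets of $\mathbb R^n$, $|\cdot|$ is the Euclidean norm, $\mathrm{dist}(a,B)=\inf_{b\in B}|a-b|$, and $\mathrm{haus}(A,B)=\max\{\sup_{a\in A}\mathrm{dist}(a,B),\sup_{b\in B}\mathrm{dist}(b,A)\}$ is the Hausdorff distance. $\Pi_B(a)=\{b\in B:|a-b|=\mathrm{dist}(a,B)\}$ is the set of projections of $a$ on $B$. For $f:[a,b]\to X$ with values in a metric space $(X,\rho)$ (Euclidean distance for vector- or real-valued functions, Hausdorff distance for $X=K(\mathbb R^n)$), the modulus of continuity is $\omega_{[a,b]}(f,\delta)=\sup\{\rho(f(x),f(y)):|x-y|\le\delta,\ x,y\in[a,b]\}$ (so $\omega_{[a,b]}(f,0)=0$). The total variation $V_a^x(f)$ of $f$ on $[a,x]$ is the supremum of $\sum_{i=1}^{M}\rho(f(t_i),f(t_{i-1}))$ over all finite $t_0<\dots<t_M$ in $[a,x]$; $f$ is of bounded variation if $V_a^b(f)<\infty$, and then $v_f(x)=V_a^x(f)$, $x\in[a,b]$. $\mathcal S_\chi$ is the set of continuous piecewise linear functions $s:[a,b]\to\mathbb R^n$ with knots at $\chi$ (i.e. affine on each $[x_i,x_{i+1}]$). The operator $A_\chi$ is applied to $\mathbb R^n$-valued functions by the same formula. A metric chain of a finite sequence of compact sets $\{A_0,\dots,A_N\}$ is a vector $(a_0,\dots,a_N)$ with $a_i\in A_i$ for all $i$, for which there is $j$, $0\le j\le N$, such that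 $a_{i-1}\in\Pi_{A_{i-1}}(a_i)$ for $1\le i\le j$ and $a_{i+1}\in\Pi_{A_{i+1}}(a_i)$ for $j\le i\le N-1$. $CH(A_0,\dots,A_N)$ denotes the set of all metric chains. The metric linear combination with coefficients $\lambda_0,\dots,\lambda_N\in\mathbb R$ is $$\bigoplus_{i=0}^N\lambda_iA_i=\Big\{\sum_{i=0}^N\lambda_ia_i:(a_0,\dots,a_N)\in CH(A_0,\dots,A_N)\Big\}.$$ The metric analogue of $A_\chi$ is the operator on set-valued functions $A^M_\chi(F,x)=\bigoplus_{i=0}^N c_i(x)F(x_i)$. *)

(* Defs.v *)
From HB Require Import structures.
From mathcomp Require Import all_boot all_order all_algebra.
From mathcomp Require Import all_classical all_reals all_analysis.

Set Implicit Arguments.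
Unset Strict Implicit.
Unset Printing Implicit Defensive.

Import Order.TTheory GRing.Theory Num.Theory.
Import numFieldNormedType.Exports.

Local Open Scope classical_set_scope.
Local Open Scope ring_scope.

(* Conventions.
   - A function on [a, b] is a total function R -> _ of which only the values on
     [a, b] matter: every definition and hypothesis is restricted to [a, b].
   - Infima, suprema, and therefore all distances, are taken in \bar R, so that
     no supremum or infimum receives a default value. *)

Section Distances.
Context {R : realType} {n : nat}.
Implicit Types (u v : 'rV[R]_n) (A B : set 'rV[R]_n).

(* The library norm `|u| on row vectors is the sup norm; it induces the same
   topology (hence the same compact sets and continuous functions). *)
Definition eucl_norm u : R := Num.sqrt (\sum_(i < n) u 0 i ^+ 2).

Definition eucl_dist u v : \bar R := (eucl_norm (u - v))%:E.

Definition dist_set u B : \bar R := ereal_inf [set eucl_dist u v | v in B].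

Definition haus A B : \bar R :=
  maxe (ereal_sup [set dist_set u B | u in A])
       (ereal_sup [set dist_set v A | v in B]).

Definition projections B u : set 'rV[R]_n :=
  [set v | B v /\ eucl_dist u v = dist_set u B].

End Distances.

Definition rdist {R : realType} (x y : R) : \bar R := `|x - y|%:E.

(* The metric rho is a parameter: eucl_dist, rdist or haus. *)
Section MetricValued.
Context {R : realType} {X : Type} (rho : X -> X -> \bar R).
Implicit Types (a b : R) (f : R -> X).

Definition modulus a b f (delta : R) : \bar R :=
  ereal_sup [set rho (f p.1) (f p.2) | p in
    [set p : R * R | [/\ a <= p.1 <= b, a <= p.2 <= b & `|p.1 - p.2| <= delta]]].

Definition metric_continuous a b f : Prop :=
  forall x : R, a <= x <= b -> forall eps : R, 0 < eps ->
  exists2 delta : R, 0 < delta &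
    forall y : R, a <= y <= b -> `|x - y| < delta ->
      (rho (f x) (f y) < eps%:E)%E.

(* The points t_0 < ... < t_M form the sequence t; for fewer than two points the
   sum is empty, so the variation on [a, a] is 0. *)
Definition metric_variation a f (x : R) : \bar R :=
  ereal_sup [set (\sum_(0 <= i < (size t).-1) rho (f t`_i.+1) (f t`_i))%E | t in
    [set t : seq R | sorted <%R t /\ {in t, forall z, a <= z <= x}]].

Definition metric_bounded_variation a b f : Prop :=
  (metric_variation a f b < +oo)%E.

(* Finite on [a, b] as soon as f has bounded variation on [a, b]. *)
Definition variation_function a f (x : R) : R := fine (metric_variation a f x).

End MetricValued.

(* Index pairs (i, i + 1) are written as pairs i k : 'I_N.+1 with
   k = i.+1 :> nat. *)
Section Partitions.
Context {R : realType} {N : nat}.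
Implicit Types chi : 'I_N.+1 -> R.

Definition is_partition (a b : R) chi : Prop :=
  [/\ (0 < N)%N, chi ord0 = a, chi ord_max = b &
      forall i k : 'I_N.+1, k = i.+1 :> nat -> chi i < chi k].

(* All the steps of a partition are positive, so that starting the maximum at 0
   does not change it. *)
Definition max_step chi : R :=
  \big[Num.max/0]_(i < N) (chi (lift ord0 i) - chi (widen_ord (leqnSn N) i)).

Definition pw_linear {n : nat} (a b : R) chi (s : R -> 'rV[R]_n) : Prop :=
  {within `[a, b], continuous s} /\
  forall i k : 'I_N.+1, k = i.+1 :> nat ->
    exists p q : 'rV[R]_n, forall t : R, chi i <= t <= chi k -> s t = p + t *: q.

Definition sample_op {n : nat} chi (c : 'I_N.+1 -> R -> R) (f : R -> 'rV[R]_n)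
    (x : R) : 'rV[R]_n :=
  \sum_(i < N.+1) c i x *: f (chi i).

End Partitions.

Section MetricChains.
Context {R : realType} {n N : nat}.
Implicit Types A : 'I_N.+1 -> set 'rV[R]_n.

Definition metric_chains A : set ('I_N.+1 -> 'rV[R]_n) :=
  [set u | (forall i, A i (u i)) /\
    exists j : 'I_N.+1, forall i k : 'I_N.+1, k = i.+1 :> nat ->
      ((k <= j)%N -> projections (A i) (u k) (u i)) /\
      ((j <= i)%N -> projections (A k) (u i) (u k))].

Definition metric_lin_comb (lambda : 'I_N.+1 -> R) A : set 'rV[R]_n :=
  [set \sum_(i < N.+1) lambda i *: u i | u in metric_chains A].

Definition metric_op (chi : 'I_N.+1 -> R) (c : 'I_N.+1 -> R -> R)
    (F : R -> set 'rV[R]_n) (x : R) : set 'rV[R]_n :=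
  metric_lin_comb (fun i => c i x) (fun i => F (chi i)).

End MetricChains.

(* Main.v *)
Require Import Defs.
From HB Require Import structures.
From mathcomp Require Import all_boot all_order all_algebra.
From mathcomp Require Import all_classical all_reals all_analysis.
From mathcomp Require Import ring lra zify.
Import Order.TTheory GRing.Theory Num.Theory.
Import numFieldNormedType.Exports.
Local Open Scope classical_set_scope.
Local Open Scope ring_scope.
Set Implicit Arguments.
Unset Strict Implicit.
Unset Printing Implicit Defensive.

(** Let v be the variation function of F, d = phi x (max_step chi), W the
    modulus of continuity of F at max_step chi and w that of v at d.  Both are
    finite because F has bounded variation, so the claim is an inequality
    between reals.

    A metric chain u of the sets F (chi i) is turned into a single-valued
    problem by its piecewise linear interpolant s.  Since s (chi i) = u i, the
    element of the metric linear combination given by u is sample_op chi c s x,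
    and the hypothesis on the operator puts it within C * modulus s d of s x.
    If x lies between the knots k and k + 1, then s x is within
    |u_(k+1) - u_k| <= W of u_k, and F x is within Hausdorff distance W of
    F (x_k).  This is [metric_op_near_sample].  One inclusion follows by
    projecting u_k on F x; for the other, a point of F x is projected on
    F (x_k) and a metric chain is drawn through the projection
    ([metric_chain_through]).  The two steps of length W give 2 * W.

    It remains to see that modulus s d <= 5 * w.  Consecutive points of a metric
    chain are at most haus (F x_k) (F x_(k+1)) <= v x_(k+1) - v x_k apart, so the
    oscillation of s is dominated by that of the piecewise linear interpolant
    of v at the same knots ([eucl_norm_interp_le]).  Inside one cell, an
    increment of this scalar interpolant over a length at most d is at most
    2 * w ([chord_increment_le]).  An interval of length at most d that meets
    several cells splits into two partial cells and a stretch between two knots,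
    where the interpolant agrees with v: 2 * w + w + 2 * w = 5 * w
    ([interp_increment_le]).

    Passing from modulus s d <= 5 * w to the error bound multiplies by C.  When
    C < 0, the approximation hypothesis instead forces every piecewise linear s
    to have zero modulus at d; taking s linear shows that either d = 0 or n = 0,
    and w = 0 in both cases ([variation_const]). *)

(** * Euclidean norm, projections and Hausdorff distance *)

Lemma continuous_big_add {R : realType} {T : topologicalType}
    {V : normedModType R} {I : Type} (r : seq I) (G : I -> T -> V) :
  (forall i, continuous (G i)) -> continuous (fun x => \sum_(i <- r) G i x).
Proof.
move=> cG; elim: r => [|i r IH] x.
  rewrite (_ : (fun _ => _) = fun=> 0); last by apply/funext => y; rewrite big_nil.
  exact: cst_continuous.
rewrite (_ : (fun _ => _) = fun y => G i y + \sum_(k <- r) G k y).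
  by apply: cvgD; [exact: cG|exact: IH].
by apply/funext => y; rewrite big_cons.
Qed.

Section EuclideanNorm.
Context {R : realType} {n : nat}.
Implicit Types (u v : 'rV[R]_n) (A B : set 'rV[R]_n).

Lemma eucl_norm_ge0 u : 0 <= eucl_norm u.
Proof. exact: sqrtr_ge0. Qed.

Lemma eucl_norm_sqr u : eucl_norm u ^+ 2 = \sum_(i < n) u 0 i ^+ 2.
Proof. by rewrite sqr_sqrtr // sumr_ge0 // => i _; rewrite sqr_ge0. Qed.

Lemma eucl_norm0_eq0 u : eucl_norm u = 0 -> u = 0.
Proof.
move=> u0; have := eucl_norm_sqr u; rewrite u0 expr0n /= => /esym/eqP.
rewrite psumr_eq0 => [/allP h|i _]; last exact: sqr_ge0.
apply/rowP => i; rewrite mxE; apply/eqP; rewrite -sqrf_eq0.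
by have := h i (mem_index_enum i); rewrite implyTb.
Qed.

Lemma eucl_norm0 : eucl_norm (0 : 'rV[R]_n) = 0.
Proof.
by rewrite /eucl_norm big1 ?sqrtr0 // => i _; rewrite mxE expr0n.
Qed.

Lemma eucl_normZ (k : R) u : eucl_norm (k *: u) = `|k| * eucl_norm u.
Proof.
rewrite /eucl_norm -sqrtr_sqr -sqrtrM ?sqr_ge0 // mulr_sumr.
by congr Num.sqrt; apply: eq_bigr => i _; rewrite mxE exprMn.
Qed.

Lemma eucl_normN u : eucl_norm (- u) = eucl_norm u.
Proof. by rewrite -scaleN1r eucl_normZ normrN1 mul1r. Qed.

(** For nonzero u and v, expand the sum of the squares of the coordinates of
    |v| u - |u| v. *)
Lemma eucl_cauchy_schwarz u v :
  \sum_(i < n) u 0 i * v 0 i <= eucl_norm u * eucl_norm v.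
Proof.
have [/eucl_norm0_eq0 ->|u0] := eqVneq (eucl_norm u) 0.
  by rewrite eucl_norm0 mul0r big1 // => i _; rewrite mxE mul0r.
have [/eucl_norm0_eq0 ->|v0] := eqVneq (eucl_norm v) 0.
  by rewrite eucl_norm0 mulr0 big1 // => i _; rewrite mxE mulr0.
have uv0 : 0 < eucl_norm u * eucl_norm v.
  by rewrite mulr_gt0 // lt0r ?u0 ?v0 eucl_norm_ge0.
have : 0 <= \sum_(i < n) (eucl_norm v * u 0 i - eucl_norm u * v 0 i) ^+ 2.
  by apply: sumr_ge0 => i _; exact: sqr_ge0.
rewrite (eq_bigr (fun i => eucl_norm v ^+ 2 * u 0 i ^+ 2
  - 2 * (eucl_norm u * eucl_norm v) * (u 0 i * v 0 i)
  + eucl_norm u ^+ 2 * v 0 i ^+ 2)) => [|i _]; last by ring.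
rewrite big_split sumrB /= -!mulr_sumr -!eucl_norm_sqr => h.
rewrite -(ler_pM2l uv0); nra.
Qed.

Lemma eucl_normD u v : eucl_norm (u + v) <= eucl_norm u + eucl_norm v.
Proof.
rewrite -(@ler_pXn2r _ 2) ?nnegrE ?addr_ge0 ?eucl_norm_ge0 //.
rewrite eucl_norm_sqr sqrrD !eucl_norm_sqr.
under eq_bigr do rewrite mxE sqrrD.
by rewrite !big_split /= mulr2n lerD2r lerD2l lerD // eucl_cauchy_schwarz.
Qed.

Lemma eucl_norm_sum I (r : seq I) (G : I -> 'rV[R]_n) :
  eucl_norm (\sum_(i <- r) G i) <= \sum_(i <- r) eucl_norm (G i).
Proof.
elim: r => [|i r IH]; first by rewrite !big_nil eucl_norm0.
by rewrite !big_cons (le_trans (eucl_normD _ _)) // lerD2l.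
Qed.

Lemma eucl_normB u v : eucl_norm (u - v) = eucl_norm (v - u).
Proof. by rewrite -opprB eucl_normN. Qed.

Lemma eucl_norm_triangle w u v :
  eucl_norm (u - v) <= eucl_norm (u - w) + eucl_norm (w - v).
Proof. by rewrite (_ : u - v = (u - w) + (w - v)) ?eucl_normD // addrA subrK. Qed.

Lemma continuous_eucl_norm : continuous (@eucl_norm R n).
Proof.
move=> u; apply: continuous_comp; last exact: sqrt_continuous.
apply: (@continuous_big_add R _ R^o) => i v.
have cv : continuous (fun v : 'rV[R]_n => v 0 i) by exact: coord_continuous.
exact: cvgM (cv v) (cv v).
Qed.

(** A continuous function attains its minimum on a compact set; the infimum
    defining the distance is therefore reached. *)
Lemma projection_exists B u : B !=set0 -> compact B ->
  exists v, projections B u v.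
Proof.
move=> B0 cB.
have [|v] := @EVT_min_rV R n (fun v => eucl_norm (u - v)) B B0 cB.
  apply: continuous_subspaceT => v.
  have cB' : continuous (fun v : 'rV[R]_n => u - v).
    move=> w; apply: (@cvgB _ _ _ (nbhs w) _ (fun=> u) id u w).
      exact: cst_continuous.
    exact: cvg_id.
  by apply: continuous_comp; [exact: cB'|exact: continuous_eucl_norm].
rewrite inE => Bv vmin; exists v; split => //; apply/eqP.
rewrite eq_le; apply/andP; split.
  by apply/ereal_infP => _ [w Bw <-]; rewrite lee_fin vmin // inE.
by apply: ereal_inf_lbound; exists v.
Qed.

Lemma dist_set_le u v B (r : R) : B v -> eucl_norm (u - v) <= r ->
  (dist_set u B <= r%:E)%E.
Proof. by move=> Bv uv; apply: ge_ereal_inf; exists (eucl_dist u v); [exists v|]. Qed.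

Lemma dist_set_ge0 u B : (0 <= dist_set u B)%E.
Proof. by apply/ereal_infP => _ [w _ <-]; rewrite lee_fin eucl_norm_ge0. Qed.

Lemma dist_set_le_haus A B u : A u -> (dist_set u B <= haus A B)%E.
Proof. by move=> Au; rewrite /haus le_max ereal_sup_ubound //; exists u. Qed.

Lemma hausC A B : haus A B = haus B A.
Proof. by rewrite /haus maxC. Qed.

Lemma haus_ge0 A B : A !=set0 -> (0 <= haus A B)%E.
Proof.
by move=> [u Au]; apply: le_trans (dist_set_le_haus _ Au); exact: dist_set_ge0.
Qed.

Lemma haus_le A B (r : R) :
  (forall u, A u -> exists2 v, B v & eucl_norm (u - v) <= r) ->
  (forall v, B v -> exists2 u, A u & eucl_norm (v - u) <= r) ->
  (haus A B <= r%:E)%E.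
Proof.
move=> AB BA; rewrite /haus ge_max; apply/andP; split; apply/ereal_supP.
  by move=> _ [u /AB[v Bv uv] <-]; exact: dist_set_le Bv uv.
by move=> _ [v /BA[u Au uv] <-]; exact: dist_set_le Au uv.
Qed.

Lemma haus_self A : A !=set0 -> haus A A = 0%E.
Proof.
move=> A0; apply/eqP; rewrite eq_le haus_ge0 // andbT; apply: haus_le => u Au;
  by exists u => //; rewrite subrr eucl_norm0.
Qed.

(** The form in which Hausdorff bounds are used: they control the distance of a
    point to any of its projections. *)
Lemma projections_haus_le A B u v (r : R) :
  A u -> projections B u v -> (haus A B <= r%:E)%E -> eucl_norm (u - v) <= r.
Proof.
move=> Au [_ uv] AB; rewrite -lee_fin -[X in (X <= _)%E]/(eucl_dist u v) uv.
exact: le_trans (dist_set_le_haus _ Au) AB.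
Qed.

End EuclideanNorm.

(** * Piecewise linear interpolation *)

Section Interpolation.
Context {R : realType} (N : nat) (x : nat -> R).
Context (x_lt : forall k, (k < N)%N -> x k < x k.+1).

(** The fraction of the cell k lying before t, clamped to [0, 1].  With ramps
    the interpolant is one formula on the whole line: continuity is immediate
    and an increment of the interpolant is a combination of the jumps of f with
    nonnegative weights that do not depend on f. *)
Definition ramp k t : R := Num.max 0 (Num.min 1 ((t - x k) / (x k.+1 - x k))).

Definition interp {V : lmodType R} (f : nat -> V) t : V :=
  f 0%N + \sum_(0 <= k < N) ramp k t *: (f k.+1 - f k).

Lemma knots_le i j : (i <= j <= N)%N -> x i <= x j.
Proof.
elim: j => [|j IH] /andP[]; first by rewrite leqn0 => /eqP ->.
rewrite leq_eqVlt => /predU1P[-> //|ij] jN.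
by rewrite (le_trans (IH _)) ?(ltW (x_lt jN)) // -ltnS ij ltnW.
Qed.

Lemma locate_knots t : (0 < N)%N -> x 0%N <= t <= x N ->
  exists2 k, (k < N)%N & x k <= t <= x k.+1.
Proof.
elim: N => // M IH _ /andP[t0 tM].
have [tlt|tge] := leP t (x M); last by exists M => //; rewrite (ltW tge).
case: M IH tM tlt => [|M] IH tM tlt.
  by exists 0%N => //; rewrite t0.
have [//||k kM kt] := IH _; first by rewrite t0.
by exists k => //; exact: ltnW.
Qed.

Lemma ramp_mono k s t : (k < N)%N -> s <= t -> ramp k s <= ramp k t.
Proof.
move=> /x_lt kN st; rewrite /ramp.
have : (s - x k) / (x k.+1 - x k) <= (t - x k) / (x k.+1 - x k).
  by rewrite ler_pM2r ?invr_gt0 ?subr_gt0 // lerD2r.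
rewrite /Num.max /Num.min; do ![case: ifP => /=]; lra.
Qed.

Lemma continuous_ramp k : continuous (ramp k).
Proof.
pose g (t : R^o) : R^o := (t - x k) * (x k.+1 - x k)^-1.
have cg : continuous g.
  move=> t; rewrite /g.
  apply: (@cvgMl _ _ (nbhs t) _ (fun t : R => t - x k)).
  by apply: cvgB; [exact: cvg_id|exact: cvg_cst].
move=> t; apply: (@continuous_max R R^o (cst 0) (cst 1 \min g)).
  exact: cst_continuous.
by apply: (@continuous_min R R^o (cst 1) g); [exact: cst_continuous|exact: cg].
Qed.

Lemma interp_diff {V : lmodType R} (f : nat -> V) s t :
  interp f t - interp f s
    = \sum_(0 <= k < N) (ramp k t - ramp k s) *: (f k.+1 - f k).
Proof.
rewrite /interp opprD addrACA subrr add0r -sumrB.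
by apply: eq_bigr => k _; rewrite scalerBl.
Qed.

(** On cell k the earlier ramps are 1, so that their terms telescope to
    f k - f 0, and the later ones are 0. *)
Lemma interp_segment {V : lmodType R} (f : nat -> V) k t :
  (k < N)%N -> x k <= t <= x k.+1 ->
  interp f t = f k + ((t - x k) / (x k.+1 - x k)) *: (f k.+1 - f k).
Proof.
move=> kN /andP[kt tk]; have h0 : 0 < x k.+1 - x k by rewrite subr_gt0 x_lt.
have quot_lt1 l s : (l < N)%N -> x l.+1 <= s -> 1 <= (s - x l) / (x l.+1 - x l).
  by move=> lN sl; rewrite ler_pdivlMr ?subr_gt0 ?x_lt // mul1r lerD2r.
rewrite /interp (big_cat_nat (n := k)) ?(ltnW kN) //= (@big_ltn _ _ _ k N) //.
rewrite [\sum_(0 <= _ < k) _](_ : _ = f k - f 0%N); last first.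
  rewrite -(telescope_sumr f (leq0n k)). apply: eq_big_nat => l /andP[_ lk].
  have lN : (l < N)%N := ltn_trans lk kN.
  rewrite /ramp min_l ?max_r ?scale1r // quot_lt1 //.
  by rewrite (le_trans _ kt) // knots_le // lk ltnW.
rewrite [\sum_(k.+1 <= _ < N) _](_ : _ = 0) ?addr0; last first.
  apply: big1_seq => l /andP[_]; rewrite mem_index_iota => /andP[kl lN].
  have tl : t <= x l by rewrite (le_trans tk) // knots_le // kl ltnW.
  have q0 : (t - x l) / (x l.+1 - x l) <= 0.
    by rewrite pmulr_lle0 ?invr_gt0 ?subr_gt0 ?x_lt // subr_le0.
  by rewrite /ramp min_r ?max_l ?scale0r // (le_trans q0).
rewrite /ramp min_r ?max_r.
- by rewrite addrA subrKC.
- by rewrite divr_ge0 ?(ltW h0) ?subr_ge0.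
- by rewrite ler_pdivrMr // mul1r lerD2r.
Qed.

Lemma interp_knot {V : lmodType R} (f : nat -> V) k :
  (0 < N)%N -> (k <= N)%N -> interp f (x k) = f k.
Proof.
move=> N0; rewrite leq_eqVlt => /predU1P[->|kN].
  rewrite (@interp_segment _ f N.-1) ?prednK // ?lexx ?knots_le ?leq_pred ?leqnn //.
  rewrite divff ?scale1r ?subrKC // subr_eq0 gt_eqF //.
  by rewrite -[X in _ < x X](prednK N0) x_lt // prednK.
rewrite (@interp_segment _ f k) // ?lexx ?(ltW (x_lt kN)) //.
by rewrite subrr mul0r scale0r addr0.
Qed.

Lemma continuous_interp {V : normedModType R} (f : nat -> V) :
  continuous (interp f).
Proof.
move=> t; apply: cvgD; first exact: cst_continuous.
apply: continuous_big_add => k s.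
by apply: cvgZl; exact: continuous_ramp.
Qed.

(** The increments of both interpolants have the same nonnegative weights on the
    jumps, so domination of the jumps passes to the increments. *)
Lemma eucl_norm_interp_le {n : nat} (f : nat -> 'rV[R]_n) (v : nat -> R) s t :
  (forall k, (k < N)%N -> eucl_norm (f k.+1 - f k) <= v k.+1 - v k) ->
  s <= t ->
  eucl_norm (interp f t - interp f s)
    <= interp (v : nat -> R^o) t - interp (v : nat -> R^o) s.
Proof.
move=> fv st; rewrite !interp_diff !big_mkord.
rewrite (le_trans (eucl_norm_sum _ _)) // ler_sum // => k _.
rewrite eucl_normZ ger0_norm ?subr_ge0 ?ramp_mono //.
by rewrite ler_wpM2l ?fv // subr_ge0 ramp_mono.
Qed.

End Interpolation.

(** * Modulus of continuity of a scalar interpolant *)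

Section ModulusOfInterpolant.
Context {R : realType} (V : R -> R) (a b d w : R).
Context (V_modulus : forall s t, a <= s <= b -> a <= t <= b -> `|s - t| <= d ->
  `|V s - V t| <= w).

Lemma increment_le s t : a <= s -> s <= t -> t <= b -> t - s <= d -> V t - V s <= w.
Proof.
move=> sa st tb std; apply: le_trans (ler_norm _) _; apply: V_modulus.
- by rewrite (le_trans sa).
- by rewrite sa (le_trans st).
- by rewrite ger0_norm ?subr_ge0.
Qed.

(** An interval of length at most m * e is covered by m steps of length at most
    e <= d, each of which costs w. *)
Lemma increment_le_muln m s t e : 0 <= e -> e <= d ->
  a <= s -> s <= t -> t <= b -> t - s <= m%:R * e -> V t - V s <= m%:R * w.
Proof.
move=> e0 ed sa; elim: m t => [|m IH] t st tb.
  rewrite !mul0r subr_le0 => ts.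
  by rewrite (_ : t = s) ?subrr //; apply/eqP; rewrite eq_le ts st.
rewrite -natr1 !mulrDl !mul1r => tsm.
(* The last step goes back from t by e, or down to s if that is closer. *)
have [u [su ut tu us]] : exists u, [/\ s <= u, u <= t, t - u <= d & u - s <= m%:R * e].
  have me0 : 0 <= m%:R * e by rewrite mulr_ge0.
  have [tes|tes] := leP (t - e) s.
    by exists s; split=> //; lra.
  by exists (t - e); split; lra.
have := IH u su (le_trans ut tb) us.
have := increment_le (le_trans sa su) ut tb tu.
lra.
Qed.

(** With h = q - p and m the least integer above h / e, the whole cell costs at
    most m * w and m <= h / e + 1; the fraction e / h of it costs at most
    (1 + e / h) * w. *)
Lemma chord_increment_le p q e : a <= p -> p < q -> q <= b ->
  0 <= e -> e <= q - p -> e <= d -> e / (q - p) * (V q - V p) <= 2 * w.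
Proof.
move=> ap pq qb e0 eh ed; have h0 : 0 < q - p by rewrite subr_gt0.
have d0 : 0 <= d := le_trans e0 ed.
have w0 : 0 <= w.
  have := @increment_le p p ap (lexx _) (le_trans (ltW pq) qb).
  by rewrite !subrr; exact.
have [->|ne0] := eqVneq e 0; first by rewrite !mul0r mulr_ge0.
have {ne0}e0 : 0 < e by rewrite lt0r ne0.
set h := q - p in eh h0 *.
have he0 : 0 <= h / e by rewrite divr_ge0 // ltW.
pose m := (Num.truncn (h / e)).+1.
have /andP[mle mgt] := truncn_itv he0.
have mE : m%:R = (Num.truncn (h / e))%:R + 1 :> R by rewrite natr1.
have Vm : V q - V p <= m%:R * w.
  by apply: (@increment_le_muln m p q e) => //; [exact: ltW|exact: ltW|
    rewrite -ler_pdivrMr // ltW].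
have eh0 : 0 < e / h by rewrite divr_gt0.
rewrite (le_trans (ler_wpM2l (ltW eh0) Vm)) // mulrA ler_wpM2r //.
have : e / h * m%:R <= e / h * (h / e + 1) by rewrite ler_pM2l // mE lerD2r.
have -> : e / h * (h / e + 1) = 1 + e / h.
  by field; rewrite !gt_eqF.
have : e / h <= 1 by rewrite ler_pdivrMr ?mul1r.
lra.
Qed.

(** The worst case is an interval that ends inside two different cells: 2 * w for
    each partial cell, and w between the knots, where the interpolant is V. *)
Lemma interp_increment_le (N : nat) (x : nat -> R) s t :
  (0 < N)%N -> (forall k, (k < N)%N -> x k < x k.+1) ->
  x 0%N = a -> x N = b -> a <= s -> s <= t -> t <= b -> t - s <= d ->
  interp N x (fun k => V (x k) : R^o) t - interp N x (fun k => V (x k) : R^o) s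
    <= 5 * w.
Proof.
move=> N0 x_lt x0 xN sa st tb std.
have xab k : (k <= N)%N -> a <= x k <= b.
  by move=> kN; rewrite -x0 -xN !(knots_le x_lt) // leqnn kN.
have w0 : 0 <= w.
  have := @increment_le s s sa (lexx _) (le_trans st tb).
  by rewrite !subrr; apply; rewrite (le_trans _ std) ?subr_ge0.
have seg k p q : (k < N)%N -> x k <= p -> p <= q -> q <= x k.+1 -> q - p <= d ->
    interp N x (fun k => V (x k) : R^o) q - interp N x (fun k => V (x k) : R^o) p
      <= 2 * w.
  move=> kN kp pq qk qpd.
  rewrite !(interp_segment x_lt _ kN) ?kp ?qk ?(le_trans kp) ?(le_trans pq) //.
  rewrite opprD addrACA subrr add0r -scalerBl -mulrBl.
  rewrite [X in X / _](_ : _ = q - p); last by lra.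
  have /andP[ak _] := xab _ (ltnW kN); have /andP[_ kb] := xab _ kN.
  apply: chord_increment_le => //; [exact: x_lt|by rewrite subr_ge0|lra].
have [|i iN /andP[ix xi]] := @locate_knots R N x s N0.
  by rewrite x0 xN sa (le_trans st).
have [tx|xt] := leP t (x i.+1).
  by rewrite (le_trans (seg i s t _ _ _ _ _)) // ler_wpM2r //; lra.
have [|j jN /andP[jx xj]] := @locate_knots R N x t N0.
  by rewrite x0 xN tb (le_trans sa).
have ij : (i < j)%N.
  rewrite ltnNge; apply/negP => ji; have := @knots_le R N x x_lt j.+1 i.+1.
  by rewrite ltnS ji iN => /(_ isT); lra.
have xij : x i.+1 <= x j by rewrite (knots_le x_lt) // ij ltnW.
have k1 := @interp_knot R N x x_lt R^o (fun k => V (x k)) i.+1 N0 iN.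
have k2 := @interp_knot R N x x_lt R^o (fun k => V (x k)) j N0 (ltnW jN).
have h1 := seg i s (x i.+1) iN ix xi (lexx _).
have h2 := seg j (x j) t jN (lexx _) jx xj.
have /andP[ai _] := xab _ iN; have /andP[_ jb] := xab _ (ltnW jN).
have h3 := increment_le ai xij jb.
rewrite k1 in h1; rewrite k2 in h2.
have := h1 _; have := h2 _; have := h3 _.
lra.
Qed.

End ModulusOfInterpolant.

(** * Increments of the variation function *)

Section Variation.
Context {R : realType} {X : Type} (rho : X -> X -> \bar R) (f : R -> X) (a b : R).
Context (rho_sym : forall p q, rho p q = rho q p).
Context (rho_ge0 : forall s t, a <= s <= b -> a <= t <= b ->
  (0 <= rho (f s) (f t))%E).

Local Notation sample_variation t :=
  (\sum_(0 <= i < (size t).-1) rho (f t`_i.+1) (f t`_i))%E.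

Lemma sample_variation_rcons t u z :
  (sample_variation (rcons (rcons t u) z)
    = sample_variation (rcons t u) + rho (f z) (f u))%E.
Proof.
rewrite !size_rcons /= big_nat_recr //=.
rewrite !nth_rcons !size_rcons ltnn ltnS leqnn !eqxx ltnn; congr (_ + _)%E.
apply: eq_big_nat => i /andP[_ it].
by rewrite (nth_rcons _ (rcons t u) z) (nth_rcons _ (rcons t u) z i)
  !size_rcons !ltnS it (ltnW it).
Qed.

Lemma sorted_lt_rcons2 (t : seq R) u z :
  sorted <%R (rcons (rcons t u) z) = sorted <%R (rcons t u) && (u < z).
Proof. by case: t => [|p t] /=; rewrite ?andbT // rcons_path last_rcons. Qed.

Lemma metric_variation_ge0 x : (0 <= metric_variation rho a f x)%E.
Proof. by apply: ereal_sup_ubound; exists [::] => //; rewrite big_nil. Qed.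

Lemma metric_variation_mono x y : x <= y ->
  (metric_variation rho a f x <= metric_variation rho a f y)%E.
Proof.
move=> xy; apply: ereal_sup_le => _ [t [ts tx] <-]; exists t => //; split=> // z.
by move=> /tx/andP[-> /le_trans]; exact.
Qed.

(** Adding the right end x as a last sample point does not decrease the sum,
    which prepares the insertion of a point beyond x. *)
Lemma sample_variation_ending_at x t : a <= x <= b ->
  sorted <%R t -> {in t, forall z, a <= z <= x} ->
  exists t', [/\ sorted <%R (rcons t' x),
    {in rcons t' x, forall z, a <= z <= x} &
    (sample_variation t <= sample_variation (rcons t' x))%E].
Proof.
move=> /andP[ax xb]; case/lastP: t => [|t u] ts tx.
  exists [::]; split => //= [z|]; last by rewrite !big_nil.
  by rewrite inE => /eqP ->; rewrite ax lexx.
have /andP[au ux] : a <= u <= x by apply: tx; rewrite mem_rcons mem_head.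
move: ux; rewrite le_eqVlt => /predU1P[ux|ux].
  by rewrite ux in ts tx *; exists t.
exists (rcons t u); split.
- by rewrite sorted_lt_rcons2 ts.
- move=> z; rewrite mem_rcons inE => /predU1P[->|/tx //].
  by rewrite ax lexx.
- rewrite sample_variation_rcons leeDl // rho_ge0 ?ax ?au //.
  by rewrite (le_trans (ltW ux)).
Qed.

Lemma sample_variation_add_le x y t : a <= x -> x <= y -> y <= b ->
  sorted <%R t -> {in t, forall z, a <= z <= x} ->
  rho (f x) (f x) = 0%E ->
  (sample_variation t + rho (f x) (f y) <= metric_variation rho a f y)%E.
Proof.
move=> ax xy yb ts tx rxx; have xab : a <= x <= b by rewrite ax (le_trans xy).
have [t' [t's t'x tt']] := sample_variation_ending_at xab ts tx.
apply: le_trans (leeD2r _ tt') _.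
move: xy; rewrite le_eqVlt => /predU1P[<-|xy].
  by rewrite rxx adde0; apply: ereal_sup_ubound; exists (rcons t' x).
rewrite rho_sym -sample_variation_rcons; apply: ereal_sup_ubound.
exists (rcons (rcons t' x) y) => //; split; first by rewrite sorted_lt_rcons2 t's.
move=> z; rewrite mem_rcons inE => /predU1P[->|/t'x/andP[-> zx]].
  by rewrite lexx (le_trans ax) ?ltW.
by rewrite (le_trans zx) ?ltW.
Qed.

Context (f_bv : metric_bounded_variation rho a b f).
Context (rho_refl : forall s, a <= s <= b -> rho (f s) (f s) = 0%E).

Lemma variation_functionE x : x <= b ->
  (variation_function rho a f x)%:E = metric_variation rho a f x.
Proof.
move=> xb; rewrite fineK // ge0_fin_numE ?metric_variation_ge0 //.
exact: le_lt_trans (metric_variation_mono xb) f_bv.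
Qed.

Lemma rho_fin_num x y : a <= x -> x <= y -> y <= b -> rho (f x) (f y) \is a fin_num.
Proof.
move=> ax xy yb; have xab : a <= x <= b by rewrite ax (le_trans xy).
have yab : a <= y <= b by rewrite yb (le_trans ax).
rewrite ge0_fin_numE ?rho_ge0 //.
apply: le_lt_trans (le_lt_trans (metric_variation_mono yb) f_bv).
have := @sample_variation_add_le x y [::] ax xy yb isT.
by rewrite big_nil add0e; apply => //; exact: rho_refl.
Qed.

(** Superadditivity of the variation, keeping only the single jump from x to y on
    the second interval. *)
Lemma rho_le_variation_increment x y : a <= x -> x <= y -> y <= b ->
  (rho (f x) (f y) <=
    (variation_function rho a f y - variation_function rho a f x)%:E)%E.
Proof.
move=> ax xy yb; have rfin := rho_fin_num ax xy yb.
rewrite EFinB !variation_functionE // ?(le_trans xy) //.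
rewrite leeBrDr; last by rewrite -variation_functionE ?(le_trans xy).
rewrite addeC -leeBrDr //; apply/ereal_supP => _ [t [ts tx] <-].
rewrite leeBrDr //; apply: sample_variation_add_le => //.
by apply: rho_refl; rewrite ax (le_trans xy).
Qed.

End Variation.

(** * Metric chains *)

Section MetricChainLemmas.
Context {R : realType} {n N : nat}.
Implicit Types (A : 'I_N.+1 -> set 'rV[R]_n) (u : 'I_N.+1 -> 'rV[R]_n).

Lemma metric_chain_step_le A u (i k : 'I_N.+1) (r : R) : metric_chains A u ->
  k = i.+1 :> nat -> (haus (A i) (A k) <= r%:E)%E -> eucl_norm (u k - u i) <= r.
Proof.
move=> [uA [j uj]] ki hr; have [kj ji] := uj i k ki.
have [le_kj|lt_jk] := leqP k j.
  by apply: projections_haus_le (uA k) (kj le_kj) _; rewrite hausC.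
rewrite eucl_normB; apply: projections_haus_le (uA i) (ji _) hr.
by rewrite -ltnS -ki.
Qed.

(** Starting from z at the index j, project repeatedly towards both ends of the
    sequence. *)
Lemma metric_chain_through A (j : 'I_N.+1) (z : 'rV[R]_n) :
  (forall i, A i !=set0 /\ compact (A i)) -> A j z ->
  exists2 u, metric_chains A u & u j = z.
Proof.
move=> cA Ajz.
have /choice[P HP] : forall p : 'I_N.+1 * 'rV[R]_n,
    exists v, projections (A p.1) p.2 v.
  by move=> [i y]; have [A0 Ac] := cA i; exact: projection_exists.
pose fwd m := iteri m (fun l y => P (inord (j + l.+1), y)) z.
pose bwd m := iteri m (fun l y => P (inord (j - l.+1), y)) z.
(* Both branches give z at j, so the backward formula also holds at i = j. *)
pose u (i : 'I_N.+1) := if (j <= i)%N then fwd (i - j)%N else bwd (j - i)%N.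
have u_bwd (i : 'I_N.+1) : (i <= j)%N -> u i = bwd (j - i)%N.
  rewrite leq_eqVlt => /predU1P[ij|ij]; last by rewrite /u leqNgt ij.
  by rewrite /u ij leqnn subnn.
have step_bwd (i k : 'I_N.+1) : k = i.+1 :> nat -> (k <= j)%N ->
    projections (A i) (u k) (u i).
  move=> ki kj; rewrite !u_bwd //; last by rewrite ltnW // -ki.
  rewrite (_ : (j - i = (j - k).+1)%N) /=; last by lia.
  rewrite (_ : inord (j - (j - k).+1) = i); first exact: (HP (i, _)).
  by apply: val_inj; rewrite /= inordK; have := ltn_ord i; lia.
have step_fwd (i k : 'I_N.+1) : k = i.+1 :> nat -> (j <= i)%N ->
    projections (A k) (u i) (u k).
  move=> ki ji; rewrite /u ji (_ : (j <= k)%N); last by lia.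
  rewrite (_ : (k - j = (i - j).+1)%N) /=; last by lia.
  rewrite (_ : inord (j + (i - j).+1) = k); first exact: (HP (k, _)).
  by apply: val_inj; rewrite /= inordK; have := ltn_ord k; lia.
have uj : u j = z by rewrite /u leqnn subnn.
exists u => //; split; last by exists j => i k ki; split; [exact: step_bwd|exact: step_fwd].
move=> i; have [ij|ji|/val_inj ->] := ltngtP i j; last by rewrite uj.
- have iN : (i.+1 < N.+1)%N by have := ltn_ord j; lia.
  by have [] := step_bwd i (Ordinal iN) erefl ij.
- have iN : (i.-1 < N.+1)%N by have := ltn_ord i; lia.
  by have [] : projections (A i) (u (Ordinal iN)) (u i) by apply: step_fwd => /=; lia.
Qed.

End MetricChainLemmas.

(** * Finiteness of the modulus of continuity *)

Section Modulus.
Context {R : realType} {X : Type} (rho : X -> X -> \bar R) (f : R -> X) (a b : R).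

Lemma le_modulus d s t : a <= s <= b -> a <= t <= b -> `|s - t| <= d ->
  (rho (f s) (f t) <= modulus rho a b f d)%E.
Proof. by move=> sab tab std; apply: ereal_sup_ubound; exists (s, t). Qed.

Lemma modulus_le d M : (forall s t, a <= s <= b -> a <= t <= b -> `|s - t| <= d ->
  (rho (f s) (f t) <= M)%E) -> (modulus rho a b f d <= M)%E.
Proof. by move=> h; apply/ereal_supP => _ [[s t] [/= sab tab std] <-]; exact: h. Qed.

Lemma modulus_fin_num d (M : R) : a <= b -> 0 <= d ->
  (forall s t, a <= s <= b -> a <= t <= b -> (0 <= rho (f s) (f t) <= M%:E)%E) ->
  modulus rho a b f d \is a fin_num.
Proof.
move=> ab d0 h; have aab : a <= a <= b by rewrite lexx.
have /andP[m0 _] := h a a aab aab.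
rewrite ge0_fin_numE.
  apply: le_lt_trans (ltry M); apply: modulus_le => s t sab tab _.
  by have /andP[] := h s t sab tab.
by apply: le_trans m0 _; apply: le_modulus => //; rewrite subrr normr0.
Qed.

End Modulus.

(** * Interpolation at the points of a partition *)

(** Knots as a sequence indexed by nat, which lets successive knots be k and
    k.+1; only the values for k <= N matter. *)
Definition knot {R : realType} {N : nat} (chi : 'I_N.+1 -> R) (k : nat) : R :=
  chi (inord k).

Section PartitionKnots.
Context {R : realType} {N : nat} (a b : R) (chi : 'I_N.+1 -> R).
Context (chi_part : is_partition a b chi).


Lemma partition_size_gt0 : (0 < N)%N. Proof. by case: chi_part. Qed.

Lemma knot_lt k : (k < N)%N -> knot chi k < knot chi k.+1.
Proof.
move=> kN; case: chi_part => _ _ _; apply.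
by rewrite !inordK // ltnS ltnW.
Qed.

Lemma knot_first : knot chi 0%N = a.
Proof. by case: chi_part => _ <- _ _; congr chi; apply: val_inj; rewrite /= inordK. Qed.

Lemma knot_last : knot chi N = b.
Proof. by case: chi_part => _ _ <- _; congr chi; apply: val_inj; rewrite /= inordK. Qed.

Lemma knot_ord (i : 'I_N.+1) : knot chi i = chi i.
Proof. by rewrite /knot inord_val. Qed.

Lemma knot_in k : (k <= N)%N -> a <= knot chi k <= b.
Proof.
by move=> kN; rewrite -knot_first -knot_last !(knots_le knot_lt) ?kN ?leqnn.
Qed.

Lemma partition_in i : a <= chi i <= b.
Proof. by rewrite -knot_ord knot_in // -ltnS. Qed.

Lemma partition_le : a <= b.
Proof. by have /andP[/le_trans] := partition_in ord0; apply. Qed.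

Lemma max_step_ge0 : 0 <= max_step chi.
Proof. exact: bigmax_ge_id. Qed.

Lemma knot_step_le k : (k < N)%N -> knot chi k.+1 - knot chi k <= max_step chi.
Proof.
move=> kN; rewrite /max_step.
have -> : knot chi k.+1 - knot chi k
    = chi (lift ord0 (Ordinal kN)) - chi (widen_ord (leqnSn N) (Ordinal kN)).
  by congr (chi _ - chi _); apply: val_inj; rewrite /= ?inordK // ltnS ltnW.
exact: le_bigmax.
Qed.

Lemma pw_linear_interp {n : nat} (f : nat -> 'rV[R]_n) :
  pw_linear a b chi (interp N (knot chi) f).
Proof.
split; first by apply: continuous_subspaceT; exact: continuous_interp.
move=> i k ki; have iN : (i < N)%N by have := ltn_ord k; rewrite ki.
set h := chi k - chi i; set D := f i.+1 - f i.
exists (f i - (chi i / h) *: D), (h^-1 *: D) => t tik.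
rewrite -(knot_ord i) in tik h *; rewrite -(knot_ord k) ki in tik h *.
rewrite (interp_segment knot_lt f iN) //.
by rewrite -/h -/D scalerA mulrBl scalerBl addrA addrAC.
Qed.

Lemma sample_op_interp {n : nat} (c : 'I_N.+1 -> R -> R)
    (u : 'I_N.+1 -> 'rV[R]_n) x :
  sample_op chi c (interp N (knot chi) (fun k => u (inord k))) x
    = \sum_(i < N.+1) c i x *: u i.
Proof.
apply: eq_bigr => i _; congr (_ *: _); rewrite -knot_ord.
by rewrite (interp_knot knot_lt) ?partition_size_gt0 ?inord_val // -ltnS.
Qed.

End PartitionKnots.

(** * Error of the metric operator *)

Section ErrorBound.
Context {R : realType} {n N : nat} (a b C : R) (chi : 'I_N.+1 -> R).
Context (chi_part : is_partition a b chi).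
Context (F : R -> set 'rV[R]_n).
Context (F_compact : forall x, a <= x <= b -> F x !=set0 /\ compact (F x)).
Context (F_bv : metric_bounded_variation haus a b F).

Local Notation V := (variation_function haus a F).

Lemma haus_values_ge0 s t : a <= s <= b -> a <= t <= b -> (0 <= haus (F s) (F t))%E.
Proof. by move=> /F_compact[Fs _] _; exact: haus_ge0. Qed.

Lemma haus_le_variation s t : a <= s -> s <= t -> t <= b ->
  (haus (F s) (F t) <= (V t - V s)%:E)%E.
Proof.
move=> sa st tb; apply: (@rho_le_variation_increment _ _ haus F a b) => //.
- exact: hausC.
- exact: haus_values_ge0.
- by move=> r /F_compact[Fr _]; exact: haus_self.
Qed.

Lemma variation_ge0 s : 0 <= V s.
Proof. by rewrite fine_ge0 // metric_variation_ge0. Qed.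

Lemma variation_mono s t : a <= s -> s <= t -> t <= b -> V s <= V t.
Proof.
move=> sa st tb; rewrite -subr_ge0 -lee_fin.
apply: le_trans (haus_le_variation sa st tb); apply: haus_values_ge0.
  by rewrite sa (le_trans st).
by rewrite tb (le_trans sa).
Qed.

Lemma haus_le_total_variation s t : a <= s <= b -> a <= t <= b ->
  (0 <= haus (F s) (F t) <= (V b)%:E)%E.
Proof.
move=> sab tab; rewrite haus_values_ge0 //=.
wlog st : s t sab tab / s <= t.
  by move=> h; have [/h|/ltW/h] := leP s t; last rewrite hausC; apply.
move: sab tab => /andP[sa sb] /andP[ta tb].
apply: le_trans (haus_le_variation sa st tb) _; rewrite lee_fin.
have := variation_mono ta tb (lexx _); have := variation_ge0 s; lra.
Qed.

Lemma variation_dist_le_total s t : a <= s <= b -> a <= t <= b ->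
  (0 <= rdist (V s) (V t) <= (V b)%:E)%E.
Proof.
move=> /andP[sa sb] /andP[ta tb]; rewrite !lee_fin normr_ge0 /= ler_norml.
have := variation_mono ta tb (lexx _); have := variation_mono sa sb (lexx _).
have := variation_ge0 s; have := variation_ge0 t; lra.
Qed.

Lemma interp_modulus_le (f : nat -> 'rV[R]_n) (d w : R) :
  (forall k, (k < N)%N ->
    eucl_norm (f k.+1 - f k) <= V (knot chi k.+1) - V (knot chi k)) ->
  (modulus rdist a b V d <= w%:E)%E ->
  (modulus eucl_dist a b (interp N (knot chi) f) d <= (5 * w)%:E)%E.
Proof.
move=> fV Vw; apply: modulus_le => s t; rewrite lee_fin.
wlog st : s t / t <= s.
  move=> h sab tab std; have [ts|/ltW st] := leP t s; first exact: h.
  by rewrite eucl_normB; apply: h => //; rewrite distrC.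
move=> /andP[sa sb] /andP[ta tb] std.
apply: le_trans (eucl_norm_interp_le (v := fun k => V (knot chi k)) _ fV st) _.
  exact: knot_lt chi_part.
apply: (@interp_increment_le _ V a b d w) => //.
- move=> p q pab qab pqd; rewrite -lee_fin; apply: le_trans Vw.
  exact: (le_modulus rdist V).
- exact: partition_size_gt0 chi_part.
- exact: knot_lt chi_part.
- exact: knot_first chi_part.
- exact: knot_last chi_part.
- by rewrite (le_trans _ std) // ler_norm.
Qed.

(** Applied to t |-> t v, the hypothesis says |p - q| |v| <= 0.  Hence as soon as
    two distinct points are within d, every vector is 0, all the sets F t are
    equal and the variation vanishes. *)
Lemma variation_const (d : R) :
  (forall s, pw_linear a b chi s -> (modulus (@eucl_dist R n) a b s d <= 0)%E) ->
  forall p q, a <= p <= b -> a <= q <= b -> `|p - q| <= d -> V p = V q.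
Proof.
move=> mod0 p q pab qab pqd; have [->//|pq] := eqVneq p q.
have vec0 (v : 'rV[R]_n) : v = 0.
  have lin : pw_linear a b chi (fun t => t *: v).
    split; last by move=> i k _; exists 0, v => t _; rewrite add0r.
    apply: continuous_subspaceT => t.
    by apply: cvgZl; exact: cvg_id.
  have := le_trans (le_modulus eucl_dist (fun t => t *: v) pab qab pqd) (mod0 _ lin).
  rewrite lee_fin -scalerBl eucl_normZ pmulr_rle0 ?normr_gt0 ?subr_eq0 // => v0.
  by apply: eucl_norm0_eq0; apply/eqP; rewrite eq_le v0 eucl_norm_ge0.
have haus0 s t : a <= s <= b -> a <= t <= b -> haus (F s) (F t) = 0%E.
  move=> /F_compact[Fs _] /F_compact[Ft _].
  rewrite (_ : F t = F s) ?haus_self //.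
  move: Fs Ft => [u Fu] [v Fv]; apply/seteqP; split=> y _.
    by rewrite (vec0 y) -(vec0 u).
  by rewrite (vec0 y) -(vec0 v).
have V0 z : a <= z <= b -> V z = 0.
  move=> /andP[az zb]; apply/eqP; rewrite eq_le variation_ge0 andbT -lee_fin.
  rewrite (@variation_functionE _ _ haus F a b) //.
  apply/ereal_supP => _ [t [_ tz] <-]; rewrite big1_seq // => i /andP[_].
  rewrite mem_index_iota => /andP[_ it].
  have tab k : (k < size t)%N -> a <= t`_k <= b.
    by move=> kt; have /andP[-> /le_trans] := tz _ (mem_nth 0 kt); exact.
  by rewrite haus0 // tab; lia.
by rewrite !V0.
Qed.

Context (c : 'I_N.+1 -> R -> R) (x d W w : R).
Context (xab : a <= x <= b) (d0 : 0 <= d).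
Context (A_approx : forall s : R -> 'rV[R]_n, pw_linear a b chi s ->
  (eucl_dist (sample_op chi c s x) (s x) <= C%:E * modulus eucl_dist a b s d)%E).
Context (FW : modulus haus a b F (max_step chi) = W%:E).
Context (Vw : modulus rdist a b V d = w%:E).

(** For C >= 0 this is monotonicity of the product.  For C < 0 the hypothesis
    bounds a nonnegative quantity by C times a nonnegative modulus, so all these
    moduli vanish, and so does w. *)
Lemma sample_op_error_le (s : R -> 'rV[R]_n) : pw_linear a b chi s ->
  (modulus eucl_dist a b s d <= (5 * w)%:E)%E ->
  eucl_norm (sample_op chi c s x - s x) <= 5 * C * w.
Proof.
move=> s_lin sw; rewrite -lee_fin; apply: le_trans (A_approx s_lin) _.
have [C0|C0] := leP 0 C.
  rewrite [5 * C]mulrC -mulrA EFinM.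
  by apply: lee_wpmul2l; rewrite ?lee_fin.
have mod0 (r : R -> 'rV[R]_n) : pw_linear a b chi r ->
    (modulus eucl_dist a b r d <= 0)%E.
  move=> /A_approx r_err; rewrite -(@nmule_rge0 _ C%:E) ?lte_fin //.
  by apply: le_trans r_err; rewrite lee_fin; exact: eucl_norm_ge0.
have xx : `|x - x| <= d by rewrite subrr normr0.
have -> : w = 0.
  apply/eqP; rewrite -eqe -Vw eq_le; apply/andP; split.
    apply: modulus_le => p q pab qab pqd.
    by rewrite (variation_const mod0 pab qab pqd) /rdist subrr normr0.
  apply: le_trans (le_modulus rdist V xab xab xx).
  by rewrite lee_fin.
rewrite mulr0 nmule_rle0 ?lte_fin //.
apply: le_trans (le_modulus eucl_dist s xab xab xx).
by rewrite lee_fin; exact: eucl_norm_ge0.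
Qed.

Lemma haus_step_le s t : a <= s <= b -> a <= t <= b -> `|s - t| <= max_step chi ->
  (haus (F s) (F t) <= W%:E)%E.
Proof. by rewrite -FW; exact: le_modulus. Qed.

(** The value s x of the interpolant of the chain serves as intermediate point:
    the operator error at s costs 5 * C * w, the distance from s x to the
    k-th point of the chain costs W. *)
Lemma metric_op_near_sample u k : metric_chains (fun i => F (chi i)) u ->
  (k < N)%N -> knot chi k <= x <= knot chi k.+1 ->
  eucl_norm (\sum_(i < N.+1) c i x *: u i - u (inord k)) <= W + 5 * C * w.
Proof.
move=> u_chain kN /andP[kx xk].
pose f j := u (inord j); pose s := interp N (knot chi) f.
have step j (r : R) : (j < N)%N ->
    (haus (F (knot chi j)) (F (knot chi j.+1)) <= r%:E)%E ->
    eucl_norm (f j.+1 - f j) <= r.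
  move=> jN; apply: metric_chain_step_le u_chain _.
  by rewrite !inordK // ltnS ltnW.
have s_err : eucl_norm (sample_op chi c s x - s x) <= 5 * C * w.
  apply: sample_op_error_le; first exact: pw_linear_interp.
  apply: interp_modulus_le; last by rewrite Vw.
  move=> j jN; apply: step => //; apply: haus_le_variation.
  - by have /andP[] := knot_in chi_part (ltnW jN).
  - exact: ltW (knot_lt chi_part jN).
  - by have /andP[] := knot_in chi_part jN.
rewrite -(sample_op_interp chi_part c u x).
apply: le_trans (eucl_norm_triangle (s x) _ _) _; rewrite addrC lerD //.
have hk := knot_lt chi_part kN.
rewrite /s (interp_segment (knot_lt chi_part) f kN) ?kx // -/(f k) addrC addKr.
have fW : eucl_norm (f k.+1 - f k) <= W.
  apply: step => //; apply: haus_step_le; [exact: knot_in (ltnW kN)|exact: knot_in|].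
  rewrite distrC ger0_norm; first exact: knot_step_le.
  by rewrite subr_ge0 ltW.
rewrite eucl_normZ ger0_norm; last by rewrite divr_ge0 // subr_ge0 // ltW.
apply: le_trans fW; rewrite ler_piMl ?eucl_norm_ge0 //.
by rewrite ler_pdivrMr ?subr_gt0 // mul1r lerD2r.
Qed.

Lemma haus_metric_op_le :
  (haus (metric_op chi c F x) (F x) <= (2 * W + 5 * C * w)%:E)%E.
Proof.
have [|k kN kx] := @locate_knots R N (knot chi) x (partition_size_gt0 chi_part).
  by rewrite (knot_first chi_part) (knot_last chi_part).
have xkW : `|x - knot chi k| <= max_step chi.
  have := knot_step_le chi kN; move: kx => /andP[kx xk].
  by rewrite ger0_norm ?subr_ge0 //; apply: le_trans; rewrite lerD2r.
have xW := haus_step_le xab (knot_in chi_part (ltnW kN)) xkW.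
apply: haus_le => [y [u u_chain <-]|z Fz].
  have [uF _] := u_chain.
  have [Fx0 Fxc] := F_compact xab.
  have [v v_proj] := projection_exists (u (inord k)) Fx0 Fxc.
  have uv : eucl_norm (u (inord k) - v) <= W.
    by apply: projections_haus_le (uF _) v_proj _; rewrite hausC.
  have yu := metric_op_near_sample u_chain kN kx.
  have [Fv _] := v_proj.
  exists v => //; apply: le_trans (eucl_norm_triangle (u (inord k)) _ _) _.
  by move: (lerD yu uv); lra.
have [Fk0 Fkc] := F_compact (knot_in chi_part (ltnW kN)).
have [v v_proj] := projection_exists z Fk0 Fkc.
have zv : eucl_norm (z - v) <= W by apply: projections_haus_le Fz v_proj xW.
have [Fv _] := v_proj.
have [|u u_chain uk] :=
  @metric_chain_through R n N (fun i => F (chi i)) (inord k) v _ Fv.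
  by move=> i; apply: F_compact; exact: partition_in chi_part i.
exists (\sum_(i < N.+1) c i x *: u i); first by exists u.
have := metric_op_near_sample u_chain kN kx; rewrite uk => uv.
apply: le_trans (eucl_norm_triangle v _ _) _.
by rewrite (eucl_normB v); move: (lerD zv uv); lra.
Qed.

End ErrorBound.

Theorem theorem5p3 (R : realType) (n N : nat) (a b : R)
    (chi : 'I_N.+1 -> R) (chi_part : is_partition a b chi)
    (C : R)
    (phi : R -> R -> R)
    (phi_ge0 : forall x t : R, a <= x <= b -> 0 <= t -> 0 <= phi x t)
    (phi_cont : {within [set p : R * R | a <= p.1 <= b /\ 0 <= p.2],
                   continuous (fun p : R * R => phi p.1 p.2)})
    (phi_mono : forall x t1 t2 : R, a <= x <= b -> 0 <= t1 -> t1 <= t2 ->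
                  phi x t1 <= phi x t2)
    (phi_0 : forall x : R, a <= x <= b -> phi x 0 = 0)
    (F : R -> set 'rV[R]_n)
    (F_compact : forall x : R, a <= x <= b -> F x !=set0 /\ compact (F x))
    (F_cont : metric_continuous haus a b F)
    (F_bv : metric_bounded_variation haus a b F)
    (c : 'I_N.+1 -> R -> R)
    (A_approx : forall s : R -> 'rV[R]_n, pw_linear a b chi s ->
       forall x : R, a <= x <= b ->
         (eucl_dist (sample_op chi c s x) (s x)
            <= C%:E * modulus eucl_dist a b s (phi x (max_step chi)))%E) :
  forall x : R, a <= x <= b ->
    (haus (metric_op chi c F x) (F x)
       <= 2%:E * modulus haus a b F (max_step chi)
          + (5 * C)%:E * modulus rdist a b (variation_function haus a F)
                           (phi x (max_step chi)))%E.
Proof.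
move=> x xab.
have d0 : 0 <= phi x (max_step chi) by rewrite phi_ge0 // max_step_ge0.
have ab := partition_le chi_part.
have /fineK FW : modulus haus a b F (max_step chi) \is a fin_num.
  exact: modulus_fin_num (max_step_ge0 chi) (haus_le_total_variation F_compact F_bv).
have /fineK Vw : modulus rdist a b (variation_function haus a F)
    (phi x (max_step chi)) \is a fin_num.
  exact: modulus_fin_num d0 (variation_dist_le_total F_compact F_bv).
rewrite -FW -Vw -!EFinM -EFinD.
apply: (haus_metric_op_le chi_part F_compact F_bv xab d0 _ (esym FW) (esym Vw)).
by move=> s s_lin; exact: A_approx.
Qed.
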